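(* Let $\beta=\frac{1+\sqrt5}2$. A word $x\in\{-1,0,1\}^*$ is a $\beta$-expansion of minimal weight if and only if $x$ contains no factor belonging to $H$, where (writing $\bar1$ for the digit $-1$) $$H = 1(0100)^*1\ \cup\ 1(0100)^*0101\ \cup\ 1(00\bar10)^*\bar1\ \cup\ 1(00\bar10)^*0\bar1\ \cup\ \bar1(0\bar100)^*\bar1\ \cup\ \bar1(0\bar100)^*0\bar10\bar1\ \cup\ \bar1(0010)^*1\ \cup\ \bar1(0010)^*01.$$ In particular this set is recognized by a finite automaton.
   Context: For a finite word $x=x_1\cdots x_n$ over $\mathbb Z$, write $.x_1\cdots x_n=\sum_{j=1}^n x_j\beta^{-j}$ and $\|x\|=\sum_{j=1}^n|x_j|$. For $x,y\in\mathbb Z^*$, $x\sim_\beta y$ means $.x=\beta^k\cdot .y$ for some $k\in\mathbb Z$. A word $x$ is $\beta$-heavy if there is $y\in\mathbb Z^*$ with $x\sim_\beta y$ and $\|y\|<\|x\|$; otherwise $x$ is a $\beta$-expansion of minimal weight. A factor is a contiguous subword; $u^*$ is the set of finite concatenations of copies of $u$. *)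

(* Defs.v *)
From HB Require Import structures.
From mathcomp Require Import all_boot all_order all_algebra.
From mathcomp Require Import reals.

Set Implicit Arguments.
Unset Strict Implicit.
Unset Printing Implicit Defensive.

Import Order.TTheory GRing.Theory Num.Theory.
Local Open Scope ring_scope.

Definition word := seq int.

(* .x_1...x_n = sum_(1 <= j <= n) x_j beta^(-j); letters are indexed from 0,
   so x`_j is x_(j+1). *)
Definition wval (R : realType) (beta : R) (x : word) : R :=
  \sum_(j < size x) (x`_j)%:~R * beta ^- j.+1.

Definition weight (x : word) : nat := (\sum_(a <- x) `|a|)%N.

Definition wequiv (R : realType) (beta : R) (x y : word) : Prop :=
  exists k : int, wval beta x = beta ^ k * wval beta y.

Definition heavy (R : realType) (beta : R) (x : word) : Prop :=
  exists y : word, wequiv beta x y /\ (weight y < weight x)%N.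

Definition minimal_weight (R : realType) (beta : R) (x : word) : Prop :=
  ~ heavy beta x.

Definition golden (R : realType) : R := (1 + Num.sqrt 5) / 2.

Definition digits3 (x : word) : bool := all (mem [:: -1; 0; 1]) x.

Definition star (u : word) (w : word) : Prop :=
  exists n : nat, w = flatten (nseq n u).

(* The language p u^* s. *)
Definition star_between (p u s : word) (w : word) : Prop :=
  exists2 v : word, star u v & w = p ++ v ++ s.

Definition H (w : word) : Prop :=
     star_between [:: 1]  [:: 0; 1; 0; 0]  [:: 1] w
  \/ star_between [:: 1]  [:: 0; 1; 0; 0]  [:: 0; 1; 0; 1] w
  \/ star_between [:: 1]  [:: 0; 0; -1; 0] [:: -1] w
  \/ star_between [:: 1]  [:: 0; 0; -1; 0] [:: 0; -1] w
  \/ star_between [:: -1] [:: 0; -1; 0; 0] [:: -1] w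
  \/ star_between [:: -1] [:: 0; -1; 0; 0] [:: 0; -1; 0; -1] w
  \/ star_between [:: -1] [:: 0; 0; 1; 0]  [:: 1] w
  \/ star_between [:: -1] [:: 0; 0; 1; 0]  [:: 0; 1] w.

(* Finite, possibly nondeterministic automata; the finite list of labelled
   edges keeps the set of labels finite although int is infinite. *)
Record automaton := Automaton {
  state : finType;
  edges : seq (state * int * state);
  initial : {set state};
  terminal : {set state}
}.

Fixpoint accepts_from (M : automaton) (q : state M) (w : word) : Prop :=
  match w with
  | [::] => q \in terminal M
  | a :: w' => exists2 q', (q, a, q') \in edges M & accepts_from q' w'
  end.

Definition accepts (M : automaton) (w : word) : Prop :=
  exists2 q, q \in initial M & accepts_from q w.

Definition recognizable (L : word -> Prop) : Prop :=
  exists M : automaton, forall w : word, accepts M w <-> L w.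

(* Main.v *)
(* Up to powers of the golden ratio, a word of weight n is a sum of n signed
   powers, and carrying with 2 = 10.01 turns every such sum into a word over
   {-1, 0, 1} of weight at most n; so competitors with digits in {-1, 0, 1}
   suffice. The factors in H have explicit lighter equivalents. Conversely, words
   avoiding H are read by a finite deterministic automaton. Reading x in this
   automaton along a competitor y, the difference s of the values read so far
   lies in Z[golden ratio] and can return to 0 only if it stays below twice the
   golden ratio. A finite table bounds the excess of the weight of x over that of
   y for each reachable pair (state, s); the bound is at most 0 for s = 0, so x is
   minimal. *)

Require Import Defs.
From HB Require Import structures.
From mathcomp Require Import all_boot all_order all_algebra.
From mathcomp Require Import reals ring lra zify.

Set Implicit Arguments.
Unset Strict Implicit.
Unset Printing Implicit Defensive.

Import Order.TTheory GRing.Theory Num.Theory.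
Local Open Scope ring_scope.

(** * The golden ratio, and values of words by Horner's scheme *)

Lemma golden_sq (R : realType) : golden R ^+ 2 = golden R + 1.
Proof.
have h : Num.sqrt (5 : R) ^+ 2 = 5 by rewrite sqr_sqrtr ?ler0n.
rewrite /golden; set s := Num.sqrt 5 in h *.
by rewrite exprMn sqrrD h; field.
Qed.

(** Consecutive Fibonacci quotients, which later serve as endpoints for integer sign tests in
    Z[golden ratio]. *)
Lemma golden_bounds (R : realType) : 8 / 5 < golden R < 13 / 8.
Proof.
have h : Num.sqrt (5 : R) ^+ 2 = 5 by rewrite sqr_sqrtr ?ler0n.
have h0 : 0 <= Num.sqrt (5 : R) by exact: sqrtr_ge0.
rewrite /golden; set s := Num.sqrt 5 in h h0 *.
by apply/andP; split; nra.
Qed.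

Lemma golden_gt0 (R : realType) : 0 < golden R.
Proof. by have /andP[h _] := golden_bounds R; lra. Qed.

Lemma golden_neq0 (R : realType) : golden R != 0.
Proof. by rewrite gt_eqF ?golden_gt0. Qed.

Lemma weight_cons a x : weight (a :: x) = (`|a| + weight x)%N.
Proof. by rewrite /weight big_cons. Qed.

Lemma weight_cat x y : weight (x ++ y) = (weight x + weight y)%N.
Proof. by rewrite /weight big_cat. Qed.

Lemma weight_nseq0 n : weight (nseq n 0) = 0%N.
Proof. by elim: n => [|n IH] /=; rewrite /weight ?big_nil // big_cons absz0 add0n -[RHS]IH. Qed.

Lemma weight_nil : weight [::] = 0%N.
Proof. exact: (weight_nseq0 0). Qed.

Definition weightE := (weight_cat, weight_cons, weight_nil, weight_nseq0).

Lemma digits3_cat x y : digits3 (x ++ y) = digits3 x && digits3 y.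
Proof. exact: all_cat. Qed.

Lemma digits3_nseq0 n : digits3 (nseq n 0).
Proof. by rewrite /digits3 all_nseq orbT. Qed.

(** The last letter gets exponent 0 and [z] is the value of what was read before, so two words can
    be compared letter by letter. *)
Definition horner (R : realType) (z : R) (x : word) : R :=
  foldl (fun z a => golden R * z + a%:~R) z x.

Lemma horner_cat (R : realType) (z : R) x y :
  horner z (x ++ y) = horner (horner z x) y.
Proof. exact: foldl_cat. Qed.

Lemma hornerE (R : realType) (z : R) x :
  horner z x = golden R ^+ size x * z + horner 0 x.
Proof.
elim: x z => [|a x IH] z /=; first by rewrite mul1r addr0.
by rewrite IH [in RHS]IH exprSr; ring.
Qed.

Lemma horner_nseq0 (R : realType) (z : R) n :
  horner z (nseq n 0) = golden R ^+ n * z.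
Proof.
elim: n z => [|n IH] z /=; first by rewrite mul1r.
by rewrite IH exprSr addr0 mulrA.
Qed.

Lemma horner_pad (R : realType) n x m :
  horner (0 : R) (nseq n 0 ++ x ++ nseq m 0) = golden R ^+ m * horner 0 x.
Proof. by rewrite !horner_cat !horner_nseq0 mulr0. Qed.

Lemma wval_horner (R : realType) x :
  horner (0 : R) x = golden R ^+ size x * wval (golden R) x.
Proof.
elim/last_ind: x => [|x a IH]; first by rewrite /wval big_ord0 mulr0.
rewrite -cats1 horner_cat IH /= cats1.
rewrite /wval size_rcons big_ord_recr /= nth_rcons ltnn eqxx mulrDr.
congr (_ + _); last by rewrite mulrCA divff ?mulr1 // expf_neq0 ?golden_neq0.
rewrite exprS -mulrA; congr (_ * (_ * _)); apply: eq_bigr => i _.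
by rewrite nth_rcons ltn_ord.
Qed.

Lemma wequiv_horner (R : realType) x y :
  wequiv (golden R) x y <->
  exists k : int, horner (0 : R) x = golden R ^ k * horner 0 y.
Proof.
have g0 := golden_neq0 R.
split=> -[k hk].
  exists (Posz (size x) + k - Posz (size y)); rewrite !wval_horner hk.
  by rewrite !expfzDr // -exprnN -!exprnP -!mulrA mulKf // expf_neq0.
exists (- Posz (size x) + k + Posz (size y)).
rewrite !expfzDr // -exprnN -!exprnP -!mulrA -wval_horner -hk wval_horner.
by rewrite mulKf // expf_neq0.
Qed.

(** * Sums of signed powers and their reduction to the digits -1, 0, 1 *)

(** Exponents may repeat and be negative, so the notion is stable under addition and scaling; it
    links arbitrary words to words over {-1, 0, 1}. *)
Inductive power_sum (R : realType) : nat -> R -> Prop :=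
| PowerSum0 : power_sum 0 (0 : R)
| PowerSumS n (z : R) (e k : int) : power_sum n z -> e \in [:: -1; 1] ->
    power_sum n.+1 (z + e%:~R * golden R ^ k).

Lemma power_sumD (R : realType) n m (z t : R) :
  power_sum n z -> power_sum m t -> power_sum (n + m) (z + t).
Proof.
move=> hz; elim=> [|{}m {}t e k ht IH he]; first by rewrite addn0 addr0.
by rewrite addnS addrA; apply: PowerSumS.
Qed.

Lemma power_sumZ (R : realType) n (z : R) (k : int) :
  power_sum n z -> power_sum n (golden R ^ k * z).
Proof.
elim=> [|{}n {}z e j hz IH he]; first by rewrite mulr0; apply: PowerSum0.
by rewrite mulrDr mulrCA -expfzDr ?golden_neq0 //; apply: PowerSumS.
Qed.

Lemma power_sum_digit (R : realType) (a : int) : power_sum `|a| (a%:~R : R).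
Proof.
have sumE (e : int) n : e \in [:: -1; 1] -> power_sum n ((e%:~R : R) *+ n).
  move=> he; elim: n => [|n IH]; first exact: PowerSum0.
  by rewrite mulrSr -[X in _ + X]mulr1 -(expr0z (golden R)); apply: PowerSumS.
case: a => n; first by have := sumE 1 n isT; rewrite -pmulrn.
by have := sumE (-1) n.+1 isT; rewrite NegzE abszN mulrNz mulNrn -pmulrn.
Qed.

Lemma power_sum_horner (R : realType) x : power_sum (weight x) (horner (0 : R) x).
Proof.
elim/last_ind: x => [|x a IH]; first by rewrite weightE; apply: PowerSum0.
rewrite -cats1 horner_cat /= !weightE addn0.
by apply: power_sumD (power_sum_digit _ _); rewrite -(expr1z (golden R)); apply: power_sumZ.
Qed.

Definition reduces (R : realType) (n : nat) (z : R) : Prop :=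
  exists y (k : int), [/\ digits3 y, (weight y <= n)%N & z = golden R ^ k * horner 0 y].

Lemma reducesW (R : realType) n m (z : R) :
  reduces n z -> (n <= m)%N -> reduces m z.
Proof. by move=> [y [k [hy hw ->]]] le_nm; exists y, k; split=> //; apply: leq_trans le_nm. Qed.

Lemma reducesZ (R : realType) n (z : R) (k : int) :
  reduces n z -> reduces n (golden R ^ k * z).
Proof.
move=> [y [j [hy hw ->]]]; exists y, (k + j); split=> //.
by rewrite mulrA expfzDr ?golden_neq0.
Qed.

Lemma reduces_word (R : realType) x : digits3 x -> reduces (weight x) (horner (0 : R) x).
Proof. by move=> hx; exists x, 0; split; rewrite ?expr0z ?mul1r. Qed.

Lemma reduces_pad (R : realType) n x i m :
  reduces n (horner (0 : R) (nseq i 0 ++ x ++ nseq m 0)) -> reduces n (horner (0 : R) x).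
Proof.
rewrite horner_pad => /(reducesZ (- Posz m)).
by rewrite -exprnN mulKf // expf_neq0 ?golden_neq0.
Qed.

Lemma digitP (a : int) : a \in [:: -1; 0; 1] -> [\/ a = -1, a = 0 | a = 1].
Proof.
by rewrite !inE => /or3P[] /eqP->; [constructor 1 | constructor 2 | constructor 3].
Qed.

Lemma signP (e : int) : e \in [:: -1; 1] -> e = -1 \/ e = 1.
Proof. by rewrite !inE => /orP[] /eqP->; [left | right]. Qed.

(* Carries use 2 = 10.01 and 12 = 101; the measure decreases because a carry to
   the right moves a nonzero digit to the left part, while a carry to the left
   lowers the total weight. *)
Lemma reduces_double (R : realType) u v (e : int) :
  digits3 u -> digits3 v -> e \in [:: -1; 1] ->
  reduces (weight u + weight v + 2) (horner (0 : R) (u ++ 2 * e :: v)).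
Proof.
(* The factor 2 pays for a carry to the left: the total weight falls by one while the right part
   gains only the digit [e]. *)
have [N] := ubnP (2 * (weight u + weight v) + weight v)%N.
elim: N u v => // N IH u v; rewrite ltnS => hN hu hv he.
(* Padding by zeros provides two letters [c], [d] before the double digit and two letters [v1], [v2]
   after it. *)
have [u' [c [d [hu' hc hd eu]]]] : exists u' (c d : int),
    [/\ digits3 u', c \in [:: -1; 0; 1], d \in [:: -1; 0; 1]
      & 0 :: 0 :: u = u' ++ [:: c; d]].
  elim/last_ind: u hu {hN} => [|u d _]; first by exists [::], 0, 0.
  rewrite -cats1 digits3_cat => /andP[hu /andP[hd _]].
  elim/last_ind: u hu => [|u c _]; first by exists [:: 0], 0, d.
  rewrite -cats1 digits3_cat => /andP[hu /andP[hc _]].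
  by exists (0 :: 0 :: u), c, d; split=> //=; rewrite -catA.
have [v1 [v2 [v' [hv1 hv2 hv' ev]]]] : exists (v1 v2 : int) v',
    [/\ v1 \in [:: -1; 0; 1], v2 \in [:: -1; 0; 1], digits3 v'
      & v ++ [:: 0; 0] = v1 :: v2 :: v'].
  case: v hv {hN} => [|v1 [|v2 v']] /=; first by exists 0, 0, [::].
    by case/andP=> h1 _; exists v1, 0, [:: 0].
  case/and3P=> h1 h2 hv; exists v1, v2, (v' ++ [:: 0; 0]); split=> //.
  by rewrite digits3_cat hv.
have wu : weight u = (weight u' + (`|c| + `|d|))%N.
  by have := congr1 weight eu; rewrite !weightE absz0; clear; lia.
have wv : weight v = (`|v1| + (`|v2| + weight v'))%N.
  by have := congr1 weight ev; rewrite !weightE absz0; clear; lia.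
apply: (@reduces_pad _ _ _ 2 2).
have -> : nseq 2 0 ++ (u ++ 2 * e :: v) ++ nseq 2 0
          = u' ++ [:: c; d; 2 * e; v1; v2] ++ v'.
  rewrite /= -[in LHS]catA /= ev -[LHS]/((0 :: 0 :: u) ++ [:: 2 * e, v1, v2 & v']).
  by rewrite eu -catA.
have rw (r : word) : horner (horner (0 : R) u') [:: c; d; 2 * e; v1; v2]
                    = horner (horner 0 u') r ->
    horner (0 : R) (u' ++ [:: c; d; 2 * e; v1; v2] ++ v') = horner 0 (u' ++ r ++ v').
  by move=> h; rewrite !horner_cat h.
have g2 := golden_sq R.
(* The carry 2 = 10.01, with [d'] standing for [d + e]. If [v2 = e], a new double digit arises two
   places to the right and induction applies. *)
have right (d' : int) : horner (horner (0 : R) u') [:: c; d; 2 * e; v1; v2]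
      = horner (horner 0 u') [:: c; d'; 0; v1; v2 + e] -> d' \in [:: -1; 0; 1] ->
    (`|d'| <= 1)%N -> (`|d'| <= `|d| + 1)%N -> (d' = 0 \/ d = 0) ->
    reduces (weight u + weight v + 2)
      (horner (0 : R) (u' ++ [:: c; d; 2 * e; v1; v2] ++ v')).
  move=> h hd' n1 n2 n3; rewrite (rw _ h).
  have [e2|ne2] := eqVneq v2 e; last first.
    apply: reducesW (reduces_word _ _) _; last first.
      have : (`|(v2 + e)%R| <= `|v2| + 1)%N by case/signP: he => ->; clear; lia.
      by rewrite !weightE wu wv absz0; clear -n1 n2; lia.
    rewrite digits3_cat hu' /= hc hd' hv1 hv' /= andbT.
    by case/digitP: hv2 ne2 => ->; case/signP: he => ->.
  have -> : u' ++ [:: c; d'; 0; v1; v2 + e] ++ v' = (u' ++ [:: c; d'; 0; v1]) ++ 2 * e :: v'.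
    by rewrite -catA /= e2 -mulr2n mulr_natl.
  have we : (`|v2| = 1)%N by rewrite e2; case/signP: he => ->.
  apply: reducesW (IH _ _ _ _ _ he) _ => //.
  - by rewrite !weightE absz0; clear -hN wu wv n2 we; lia.
  - by rewrite digits3_cat hu' /= hc hd' hv1.
  - by rewrite !weightE absz0; clear -wu wv n2 we; lia.
have eD : d = 0 \/ d = - e \/ d = e.
  by case/digitP: hd => ->; case/signP: he => ->; rewrite ?opprK; auto.
have he3 : e \in [:: -1; 0; 1] by case/signP: he => ->.
have we : (`|e| = 1)%N by case/signP: he => ->.
case: eD => [d0|[dN|de]].
- apply: (right e) => //; last by right.
  + by rewrite /= d0 !intrD; ring: g2.
  + by rewrite we.
  + by rewrite we addn1.
- apply: (right 0) => //; last by left.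
  by rewrite /= dN !intrD; ring: g2.
(* Now [d + e] would leave the digit set, hence the carry 12 = 101; a new double digit arises only
   if [c = e]. *)
rewrite (rw [:: c + e; 0; e; v1; v2]); last first.
  by rewrite /= de !intrD; ring: g2.
have wd : (`|d| = 1)%N by rewrite de.
have [ce|nce] := eqVneq c e; last first.
  apply: reducesW (reduces_word _ _) _; last first.
    by rewrite !weightE wu wv absz0; clear -we wd; lia.
  rewrite digits3_cat hu' /= he3 hv1 hv2 hv' /= andbT.
  by case/digitP: hc nce => ->; case/signP: he => ->.
have wc : (`|c| = 1)%N by rewrite ce.
have -> : u' ++ [:: c + e; 0; e; v1; v2] ++ v' = u' ++ 2 * e :: [:: 0; e; v1; v2] ++ v'.
  by rewrite /= ce -mulr2n mulr_natl.
apply: reducesW (IH _ _ _ _ _ he) _ => //.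
- by rewrite !weightE absz0; clear -hN wu wv we wc wd; lia.
- by rewrite digits3_cat /= he3 hv1 hv2 hv'.
- by rewrite !weightE absz0; clear -wu wv we wc wd; lia.
Qed.

(** After scaling and padding, the added power falls on a single digit [d]. Only [d = e] leads out
    of the digit set, and then [reduces_double] applies. *)
Lemma reducesS (R : realType) n (z : R) (e k : int) :
  reduces n z -> e \in [:: -1; 1] -> reduces n.+1 (z + e%:~R * golden R ^ k).
Proof.
have g0 := golden_neq0 R.
move=> [y [j [hy hw ->]]] he.
have -> : golden R ^ j * horner 0 y + e%:~R * golden R ^ k =
          golden R ^ j * (horner 0 y + e%:~R * golden R ^ (k - j)).
  by rewrite mulrDr mulrCA -expfzDr // addrCA subrr addr0.
apply: reducesZ; move: (k - j) => {j}k.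
have [y' [m [hy' hw' ey']]] : exists y' m, [/\ digits3 y', weight y' = weight y &
   horner (0 : R) y + e%:~R * golden R ^ k =
   golden R ^ (k - Posz m) * (horner 0 y' + e%:~R * golden R ^ m)].
  have shift m : exists y', [/\ digits3 y', weight y' = weight y &
      horner (0 : R) y' = golden R ^+ m * horner 0 y].
    exists (nseq 0 0 ++ y ++ nseq m 0); split; last exact: horner_pad.
      by rewrite !digits3_cat hy !digits3_nseq0.
    by rewrite !weightE addn0.
  case: k => k.
    exists y, k; split=> //.
    by rewrite subrr expr0z mul1r.
  have [y' [h1 h2 h3]] := shift k.+1.
  exists y', 0%N; split=> //.
  rewrite subr0 expr0z mulr1 mulrDr h3 NegzE -exprnN mulKf ?expf_neq0 //.
  by rewrite [X in _ + X]mulrC.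
rewrite ey'; apply: reducesZ.
rewrite -ltnS in hw.
have [x [d [v [eq_x sz_v]]]] : exists x (d : int) v,
    nseq m.+1 0 ++ y' = x ++ d :: v /\ size v = m.
  have sz : (m < size (nseq m.+1 (0 : int) ++ y'))%N by rewrite size_cat size_nseq; lia.
  set w := nseq m.+1 0 ++ y' in sz *.
  exists (take (size w - m.+1) w), (nth 0 w (size w - m.+1)), (drop (size w - m) w).
  split; last by rewrite size_drop subKn // ltnW.
  rewrite -[LHS](cat_take_drop (size w - m.+1)); congr (_ ++ _).
  by rewrite (drop_nth 0) ?subnSK ?leq_subr.
have -> : horner 0 y' = horner (0 : R) (x ++ d :: v).
  by rewrite -eq_x horner_cat horner_nseq0 mulr0.
have := digits3_nseq0 m.+1; have := weight_cat (nseq m.+1 0) y'.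
rewrite eq_x !weightE add0n hw' => wy dz.
have : digits3 (x ++ d :: v) by rewrite -eq_x digits3_cat dz.
rewrite digits3_cat /= => /and3P[hx hd hv].
have -> : horner 0 (x ++ d :: v) + e%:~R * golden R ^ m = horner 0 (x ++ (d + e) :: v) :> R.
  by rewrite !horner_cat /= hornerE [in RHS]hornerE sz_v intrD -exprnP; ring.
have [de|nde] := eqVneq d e.
  have -> : d + e = 2 * e by rewrite de -mulr2n mulr_natl.
  apply: reducesW (reduces_double _ hx hv he) _.
  have we : (`|d| = 1)%N by rewrite de; case/signP: he => ->.
  by lia.
apply: reducesW (reduces_word _ _) _; last first.
  rewrite !weightE; have : (`|(d + e)%R| <= `|d| + 1)%N by case/signP: he => ->; lia.
  lia.
rewrite digits3_cat hx /= hv andbT.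
by case/digitP: hd nde => ->; case/signP: he => ->.
Qed.

Lemma power_sum_reduces (R : realType) n (z : R) : power_sum n z -> reduces n z.
Proof.
elim=> [|{}n {}z e k _ IH he]; last exact: reducesS.
by exists [::], 0; split; rewrite ?weight_nil ?mulr0.
Qed.

(** Power sums free the competitor from constraints on digits and alignment; [power_sum_reduces]
    turns a sum back into a word. *)
Lemma heavyP (R : realType) x :
  heavy (golden R) x <->
  exists2 n, (n < weight x)%N & power_sum n (horner (0 : R) x).
Proof.
split=> [[y [/wequiv_horner [k hk] lt_yx]]|[n lt_nx /power_sum_reduces [y [k [_ le_yn hk]]]]].
  exists (weight y) => //; rewrite hk.
  exact: power_sumZ (power_sum_horner _ _).
exists y; split; last exact: leq_ltn_trans lt_nx.
by apply/wequiv_horner; exists k.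
Qed.

(** * Heaviness of the words containing a factor in H *)

(** Prefix, replacement and suffix are added as power sums, so [y] may be longer than [h] and
    overlap its neighbours. *)
Lemma heavy_factor (R : realType) u h v i j y :
  horner (0 : R) (nseq i 0 ++ h ++ nseq j 0) = horner 0 y ->
  (weight y < weight h)%N -> heavy (golden R) (u ++ h ++ v).
Proof.
move=> hy lt_yh; apply/heavyP.
exists (weight u + (weight y + weight v))%N; first by rewrite !weightE; lia.
rewrite !horner_cat hornerE (hornerE (horner 0 u)) mulrDr -addrA !exprnP.
apply: power_sumD; first exact/power_sumZ/power_sumZ/power_sum_horner.
apply: power_sumD (power_sum_horner _ _); apply: power_sumZ.
have -> : horner 0 h = golden R ^ (- Posz j) * horner 0 y.
  by rewrite -hy horner_pad -exprnN mulKf // expf_neq0 ?golden_neq0.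
exact/power_sumZ/power_sum_horner.
Qed.

Lemma horner_nseq_diff (R : realType) (s : R) u u' :
  (forall z t, z - t = s -> horner z u - horner t u' = s) ->
  forall n z t, z - t = s ->
    horner z (flatten (nseq n u)) - horner t (flatten (nseq n u')) = s.
Proof.
move=> hu; elim=> //= n IH z t hzt.
by rewrite !horner_cat; apply: IH; apply: hu.
Qed.

(* [s] is the constant difference between the values of the two padded words
   after each period. *)
Lemma heavy_star_factor (R : realType) (s : R) i p u c j p' u' c' h x :
  horner 0 (nseq i 0 ++ p) - horner 0 p' = s ->
  (forall z t, z - t = s -> horner z u - horner t u' = s) ->
  (forall z t, z - t = s -> horner z (c ++ nseq j 0) = horner t c') ->
  weight u' = weight u -> (weight p' + weight c' < weight p + weight c)%N ->
  star_between p u c h -> infix h x -> heavy (golden R) x.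
Proof.
move=> hp hu hc wu wpc [_ [n ->] ->] /infixP [x1 [x2 ->]].
apply: (@heavy_factor _ _ _ _ i j (p' ++ flatten (nseq n u') ++ c')).
  rewrite -!catA (catA _ p) !(horner_cat _ (_ ++ _)) !(horner_cat _ p').
  rewrite !(horner_cat _ (flatten _)).
  exact/hc/horner_nseq_diff.
have -> : weight (p ++ flatten (nseq n u) ++ c)
          = (weight p + weight c + weight (flatten (nseq n u)))%N.
  by rewrite !weightE; lia.
suff -> : weight (flatten (nseq n u)) = weight (flatten (nseq n u')) by rewrite !weightE; lia.
by elim: n => //= n IH; rewrite !weightE IH wu.
Qed.

(* The heavy words and their lighter equivalents, aligned:
   01(0100)^n 1 = 10(000-1)^n 0,    01(0100)^n 01010 = 10(000-1)^n 0000-1,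
   1(00-10)^n -10 = 0(1000)^n 01,   1(00-10)^n 0-1 = 0(1000)^n 10. *)
Lemma heavy_signed_factor (R : realType) (e : int) h x : e \in [:: -1; 1] ->
  [\/ star_between [:: e] [:: 0; e; 0; 0] [:: e] h,
      star_between [:: e] [:: 0; e; 0; 0] [:: 0; e; 0; e] h,
      star_between [:: e] [:: 0; 0; -e; 0] [:: -e] h
    | star_between [:: e] [:: 0; 0; -e; 0] [:: 0; -e] h] ->
  infix h x -> heavy (golden R) x.
Proof.
move=> he; have g2 := golden_sq R.
(* The constant differences are those of 01 against 10 and of 1 against 0, multiplied by [e]. *)
case; [apply: (@heavy_star_factor _ (e%:~R * (1 - golden R)) 1 _ _ _ 0
                 [:: e; 0] [:: 0; 0; 0; -e] [:: 0])
      |apply: (@heavy_star_factor _ (e%:~R * (1 - golden R)) 1 _ _ _ 1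
                 [:: e; 0] [:: 0; 0; 0; -e] [:: 0; 0; 0; 0; -e])
      |apply: (@heavy_star_factor _ e%:~R 0 _ _ _ 1 [:: 0] [:: e; 0; 0; 0] [:: 0; e])
      |apply: (@heavy_star_factor _ e%:~R 0 _ _ _ 0 [:: 0] [:: e; 0; 0; 0] [:: e; 0])].
all: try by move=> z t /eqP; rewrite subr_eq => /eqP-> /=; rewrite ?intrN; ring: g2.
all: try by rewrite /=; ring.
all: by rewrite !weightE; case/signP: he => ->.
Qed.

Lemma heavy_H (R : realType) h x : H h -> infix h x -> heavy (golden R) x.
Proof.
have h1 := @heavy_signed_factor R 1 h x isT.
have h2 := @heavy_signed_factor R (-1) h x isT; rewrite opprK in h2.
rewrite /H => -[|[|[|[|[|[|[|]]]]]]] hh;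
  [apply: h1; constructor 1 | apply: h1; constructor 2
  |apply: h1; constructor 3 | apply: h1; constructor 4
  |apply: h2; constructor 1 | apply: h2; constructor 2
  |apply: h2; constructor 3 | apply: h2; constructor 4]; exact: hh.
Qed.

(** * Deterministic reading of the words that avoid H *)

(* (p, u, F) stands for the words p u^* t of H with t in F. *)
Definition pattern := (int * word * seq word)%type.

Definition patterns : seq pattern :=
  [:: (1,  [:: 0; 1; 0; 0],  [:: [:: 1]; [:: 0; 1; 0; 1]]);
      (1,  [:: 0; 0; -1; 0], [:: [:: -1]; [:: 0; -1]]);
      (-1, [:: 0; -1; 0; 0], [:: [:: -1]; [:: 0; -1; 0; -1]]);
      (-1, [:: 0; 0; 1; 0],  [:: [:: 1]; [:: 0; 1]])].

Definition pat (i : nat) : pattern := nth (0, [::], [::]) patterns i.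
Definition head_digit i : int := (pat i).1.1.
Definition period i : word := (pat i).1.2.
Definition stop_words i : seq word := (pat i).2.

(* The item (i, k) records that the word read so far ends with the head digit
   of pattern i, some periods, and the first k letters of one more period.
   A state is the list of the items that hold. *)
Definition item := (nat * nat)%type.
Definition items : seq item := [seq (i, k) | i <- iota 0 4, k <- iota 0 4].

Definition starts (a : int) (m : item) := (m.2 == 0%N) && (head_digit m.1 == a).

(* The default 2 of [nth] is not a digit. *)
Definition advances (l : item) (a : int) (m : item) :=
  [&& l.1 == m.1, nth 2 (period l.1) l.2 == a
    & m.2 == (if l.2 == 3 then 0%N else l.2.+1)].

Definition next (q : seq item) (a : int) : seq item :=
  [seq m <- items | starts a m || has (fun l => advances l a m) q].

(** Every tail in F is a proper prefix of the period followed by one letter, so an item and the next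
    letter suffice to detect it. *)
Definition stops (q : seq item) (a : int) : bool :=
  has (fun l => rcons (take l.2 (period l.1)) a \in stop_words l.1) q.

Definition alphabet : seq int := [:: -1; 0; 1].

Definition delta (q : seq item) (a : int) : option (seq item) :=
  if (a \in alphabet) && ~~ stops q a then Some (next q a) else None.

Fixpoint run (q : seq item) (x : word) : bool :=
  if x is a :: x' then
    if delta q a is Some q' then run q' x' else false
  else true.

Definition holds (w : word) (l : item) : Prop :=
  exists w0 n, w = w0 ++ head_digit l.1 :: flatten (nseq n (period l.1)) ++ take l.2 (period l.1).

Lemma itemsP m : m \in items -> (m.1 < 4)%N /\ (m.2 < 4)%N.
Proof. by move=> hm; apply/andP; move: m hm; apply/allP. Qed.

Lemma size_period i : (i < 4)%N -> size (period i) = 4%N.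
Proof. by case: i => [|[|[|[|]]]]. Qed.

Lemma holds_next q w a : (forall l, l \in q -> holds w l) ->
  forall m, m \in next q a -> holds (rcons w a) m.
Proof.
move=> hq m; rewrite mem_filter => /andP[+ /itemsP[lt_m1 lt_m2]].
case/orP=> [/andP[/eqP m2 /eqP ea]|/hasP[l /hq[w0 [n ew]] /and3P[/eqP el /eqP ea /eqP em]]].
  by exists w, 0%N; rewrite m2 take0 /= ea cats1.
rewrite el in ea ew; have sz := size_period lt_m1.
exists w0; case: eqP em => [l2|l2] em; last first.
  have lt_l : (l.2 < size (period m.1))%N by rewrite sz ltnW // -em.
  exists n; rewrite em (take_nth 2 lt_l) ea ew.
  by rewrite rcons_cat rcons_cons rcons_cat.
(* The fourth letter completes a period: the item returns to position 0 with one more copy. *)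
exists n.+1; rewrite em take0 cats0 ew l2 rcons_cat rcons_cons rcons_cat; congr (_ ++ _ :: _).
have -> : rcons (take 3 (period m.1)) a = period m.1.
  by rewrite -ea l2 -take_nth ?sz // take_oversize ?sz.
by rewrite -[n.+1]addn1 nseqD flatten_cat /= cats0.
Qed.

Lemma stop_words_H i n t : t \in stop_words i ->
  H (head_digit i :: flatten (nseq n (period i)) ++ t).
Proof.
have st p u s : star_between [:: p] u s (p :: flatten (nseq n u) ++ s).
  by exists (flatten (nseq n u)) => //; exists n.
case: i => [|[|[|[|i]]]]; last by rewrite /stop_words /pat nth_default.
all: by rewrite /H !inE => /orP[] /eqP->; do ?[by left; exact: st | right]; exact: st.
Qed.

(** A digit is refused only because of an item that holds; the suffix it describes, extended by that
    digit, is a word of H. *)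
Lemma run_avoids_H q w x : (forall l, l \in q -> holds w l) -> digits3 x ->
  ~ (exists2 h : word, H h & infix h (w ++ x)) -> run q x.
Proof.
elim: x q w => //= a x IH q w hq /andP[ha hx] noH.
rewrite /delta ha /=; have [/hasP[l /hq[w0 [n ew]] hl]|_] := boolP (stops q a); last first.
  by apply: (IH _ (rcons w a)); [exact: holds_next | | rewrite cat_rcons].
case: noH.
exists (head_digit l.1 :: flatten (nseq n (period l.1)) ++ rcons (take l.2 (period l.1)) a).
  exact: stop_words_H.
apply/infixP; exists w0, x.
by rewrite ew -!catA /= -!catA cat_rcons.
Qed.

(** No word of H ends with 0, so reading 0 never stops the run. This allows padding to align
    competitors. *)
Lemma run_cat_nseq0 q x n : run q (x ++ nseq n 0) = run q x.
Proof.
elim: x q => [|a x IH] q /=; last by case: (delta q a).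
elim: n q => //= n IH q; rewrite /delta /=.
suff -> : stops q 0 = false by exact: IH.
apply/hasPn => -[i k] _ /=; apply/negP => hs.
have /allP/(_ _ hs) : all (fun t => last 0 t != 0) (stop_words i).
  by case: i {hs} => [|[|[|[|i]]]] //; rewrite /stop_words /pat nth_default.
by rewrite last_rcons eqxx.
Qed.

Lemma run_nseq0_cat x n : run [::] (nseq n 0 ++ x) = run [::] x.
Proof. by elim: n. Qed.

(** * Sign tests in Z[golden ratio] and divergence of distant values *)

(* [(a, b)] stands for the number [a + b * golden R]. *)
Definition gint := (int * int)%type.

Definition gval (R : realType) (s : gint) : R := s.1%:~R + s.2%:~R * golden R.

(* The signs of a + b * t at t = 8/5 and t = 13/8, which enclose the golden ratio. *)
Definition gnonneg (s : gint) : bool := (0 <= 5 * s.1 + 8 * s.2) && (0 <= 8 * s.1 + 13 * s.2).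
Definition gpos (s : gint) : bool := (0 < 5 * s.1 + 8 * s.2) && (0 < 8 * s.1 + 13 * s.2).

Definition far (s : gint) : bool :=
  gnonneg (s.1, s.2 - 2) || gnonneg (- s.1, - s.2 - 2).

(** Affine interpolation between 8/5 and 13/8, which are 1/40 apart: the weights are 40 (13/8 - g)
    and 40 (g - 8/5). *)
Lemma gval_barycentre (R : realType) (A B g : R) :
  A + B * g = 8 * (13 / 8 - g) * (5 * A + 8 * B) + 5 * (g - 8 / 5) * (8 * A + 13 * B).
Proof. by field. Qed.

Lemma gnonneg_ge0 (R : realType) s : gnonneg s -> 0 <= gval R s.
Proof.
case: s => a b /andP[/=]; rewrite /gval /= -!(ler_int R) !intrD !intrM => h1 h2.
have /andP[g1 g2] := golden_bounds R.
by rewrite gval_barycentre addr_ge0 // mulr_ge0 // mulr_ge0 // subr_ge0 ltW.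
Qed.

Lemma gpos_gt0 (R : realType) s : gpos s -> 0 < gval R s.
Proof.
case: s => a b /andP[/=]; rewrite /gval /= -!(ltr_int R) !intrD !intrM => h1 h2.
have /andP[g1 g2] := golden_bounds R.
by rewrite gval_barycentre addr_gt0 // mulr_gt0 // mulr_gt0 // subr_gt0.
Qed.

Lemma gvalN (R : realType) s : gval R (- s.1, - s.2) = - gval R s.
Proof. by rewrite /gval /= !intrN; ring. Qed.

Lemma far_ge (R : realType) s : far s -> 2 * golden R <= `|gval R s|.
Proof.
case: s => a b /orP[] /(@gnonneg_ge0 R); rewrite /gval /= intrD ?intrN => h.
  by rewrite ler_normr; apply/orP; left; lra.
by rewrite ler_normr; apply/orP; right; lra.
Qed.

Lemma gval_step (R : realType) (z t : R) (a b : int) s : z - t = gval R s ->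
  (golden R * z + a%:~R) - (golden R * t + b%:~R) = gval R (s.2 + (a - b), s.1 + s.2).
Proof.
move=> /eqP; rewrite subr_eq => /eqP->; rewrite /gval /= !intrD intrN.
by have g2 := golden_sq R; ring: g2.
Qed.

Lemma digit_diff (R : realType) (a b : int) : a \in alphabet -> b \in alphabet ->
  `|(a - b)%:~R| <= 2 :> R.
Proof.
move=> ha hb; have : `|a - b| <= 2 by case/digitP: ha => ->; case/digitP: hb => ->.
by rewrite -(ler_int R) intr_norm.
Qed.

(* 2 * golden R is fixed by t |-> golden R * t - 2, and digits differ by at most 2. *)
Lemma far_horner_neq (R : realType) (z t : R) x y : size x = size y ->
  digits3 x -> digits3 y -> 2 * golden R <= `|z - t| -> horner z x != horner t y.
Proof.
elim: x y z t => [|a x IH] [|b y] //= z t.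
  move=> _ _ _ h; rewrite -subr_eq0 -normr_gt0; apply: lt_le_trans h.
  by rewrite mulr_gt0 ?golden_gt0.
case=> sz /andP[ha hx] /andP[hb hy] h; apply: IH => //.
have -> : golden R * z + a%:~R - (golden R * t + b%:~R) = golden R * (z - t) + (a - b)%:~R.
  by rewrite intrB; ring.
have hd := digit_diff R ha hb.
have := lerB_normD (golden R * (z - t)) (a - b)%:~R.
rewrite normrM gtr0_norm ?golden_gt0 //; have := golden_sq R.
have := golden_gt0 R; set n := `|z - t| in h *; set g := golden R in h *; nra.
Qed.

(** * Verified bounds on the excess of weight *)

(* Entries (s, c) of a state q: after reading x to q and y along it, with
   difference s of the values, the weight of x exceeds that of y by at most c. *)
Definition table := seq (seq item * seq (gint * int)).

Definition lookup (T : table) (q : seq item) : seq (gint * int) :=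
  flatten [seq g.2 | g <- T & g.1 == q].

(** A far difference cannot return to 0, so it requires no entry. *)
Definition covered (L : seq (gint * int)) (s : gint) (c : int) : bool :=
  far s || has (fun e => (e.1 == s) && (c <= e.2)) L.

Definition gsucc (s : gint) (a b : int) : gint := (s.2 + (a - b), s.1 + s.2).

Definition gain (c a b : int) : int := c + `|a| - `|b|.

(* [insert] and [explore] only search for the table, which is then verified by
   [transitions_covered] and [admissible]. *)
Fixpoint insert (T : table) (q : seq item) (f : gint * int) : table :=
  if T is g :: T' then
    if g.1 == q then (q, f :: [seq e <- g.2 | e.1 != f.1]) :: T'
    else g :: insert T' q f
  else [:: (q, [:: f])].

Fixpoint explore (fuel : nat) (T : table) (todo : seq (seq item * (gint * int))) : table :=
  match fuel, todo with
  | n.+1, (q, (s, c)) :: todo' =>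
    if covered (lookup T q) s c then explore n T todo'
    else explore n (insert T q (s, c))
      (todo' ++ flatten [seq if delta q a is Some q'
                   then [seq (q', (gsucc s a b, gain c a b)) | b <- alphabet]
                   else [::] | a <- alphabet])
  | _, _ => T
  end.

(** The search starts from the empty state with equal values and equal weights. Whether the fuel
    suffices is settled by [potential_covered]. *)
Definition potential : table := Eval vm_compute in explore 10000 [::] [:: ([::], ((0, 0), 0))].

(** For a nonzero pair the sign test certifies a nonzero real value, so equal final values force the
    pair (0, 0). *)
Definition admissible (e : gint * int) : bool :=
  if e.1 == (0, 0) then e.2 <= 0 else gpos e.1 || gpos (- e.1.1, - e.1.2).

Definition transitions_covered (T : table) : bool :=
  all (fun g => all (fun a =>
    if delta g.1 a is Some q' then
      let L := lookup T q' in
      all (fun e => all (fun b => covered L (gsucc e.1 a b) (gain e.2 a b)) alphabet) g.2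
    else true) alphabet) T.
Lemma potential_covered : transitions_covered potential.
Proof. by vm_compute. Qed.

Lemma potential_admissible : all (fun g => all admissible g.2) potential.
Proof. by vm_compute. Qed.

Lemma mem_lookup (T : table) q e :
  e \in lookup T q -> exists2 g, g \in T & g.1 = q /\ e \in g.2.
Proof.
case/flattenP=> L /mapP[g]; rewrite mem_filter => /andP[/eqP gq hg] -> he.
by exists g.
Qed.

Lemma covered_step q a b q' e : a \in alphabet -> b \in alphabet ->
  delta q a = Some q' -> e \in lookup potential q ->
  covered (lookup potential q') (gsucc e.1 a b) (gain e.2 a b).
Proof.
move=> ha hb edq /mem_lookup[g hg [gq he]].
have hc := allP potential_covered _ hg; have {}hc := allP hc _ ha.
rewrite gq edq in hc; have {}hc := allP hc _ he.
exact: (allP hc _ hb).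
Qed.

(** The entry bounds the excess accumulated so far, and induction runs over the unread letters; at
    the end the difference is 0 and admissibility gives a bound at most 0. *)
Lemma weight_le_of_lookup (R : realType) x y q e (z t : R) :
  size x = size y -> digits3 x -> digits3 y -> run q x ->
  e \in lookup potential q -> z - t = gval R e.1 -> horner z x = horner t y ->
  e.2 + (weight x)%:Z <= (weight y)%:Z.
Proof.
elim: x y q e z t => [|a x IH] [|b y] // q e z t sz hx hy hr.
  case/mem_lookup=> g hg [_ he] hzt /= ezt.
  have /allP/(_ _ he) : all admissible g.2 by exact: (allP potential_admissible _ hg).
  rewrite /admissible !weight_nil addr0; case: eqP => // _.
  have e0 : gval R e.1 = 0 by rewrite -hzt ezt subrr.
  by case/orP=> /(@gpos_gt0 R); rewrite ?gvalN e0 ?oppr0 ltxx.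
move=> he hzt /= ezt.
move: sz hx hy => [sz] /andP[ha hx] /andP[hb hy].
move: hr => /=; case edq: (delta q a) => [q'|] // hr.
have hc := covered_step ha hb edq he.
have hzt' := gval_step a b hzt.
case/orP: hc => [hfar|/hasP[e' he' /andP[/eqP e's le_e']]].
  have := @far_horner_neq R (golden R * z + a%:~R) (golden R * t + b%:~R) x y sz hx hy.
  by rewrite hzt' far_ge // ezt eqxx => /(_ isT).
rewrite -/(gsucc _ _ _) -e's in hzt'.
have := IH _ _ _ _ _ sz hx hy hr he' hzt' ezt.
rewrite !weight_cons !PoszD !abszE; move: le_e'; rewrite /gain.
move: (weight x) (weight y) (e.2) (e'.2) `|a| `|b| => w w1 c c1 n n1; lia.
Qed.

Lemma run_minimal (R : realType) x :
  digits3 x -> run [::] x -> minimal_weight (golden R) x.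
Proof.
move=> hx hr /heavyP[n lt_nx /power_sum_reduces[y [k [hy le_yn exy]]]].
(* The power of the golden ratio goes to whichever side makes its exponent nonnegative. *)
have [j1 [j2 ej]] : exists j1 j2, golden R ^+ j1 * horner 0 x = golden R ^+ j2 * horner 0 y.
  case: k exy => m ->; first by exists 0%N, m; rewrite mul1r.
  by exists m.+1, 0%N; rewrite NegzE -exprnN mulVKf ?mul1r // expf_neq0 ?golden_neq0.
(* Zeros on the right realise these powers; zeros on the left equalise the lengths. *)
pose x' := nseq (size y + j2) 0 ++ x ++ nseq j1 0.
pose y' := nseq (size x + j1) 0 ++ y ++ nseq j2 0.
have start_in : ((0, 0), 0) \in lookup potential [::] by vm_compute.
have sz : size x' = size y' by rewrite !size_cat !size_nseq addnC.
have hx' : digits3 x' by rewrite !digits3_cat !digits3_nseq0 hx.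
have hy' : digits3 y' by rewrite !digits3_cat !digits3_nseq0 hy.
have hr' : run [::] x' by rewrite run_nseq0_cat run_cat_nseq0.
have h0 : (0 : R) - 0 = gval R (0, 0) by rewrite /gval /= mul0r addr0 subr0.
have := weight_le_of_lookup sz hx' hy' hr' start_in h0.
rewrite !horner_pad => /(_ ej); rewrite !weightE /=; lia.
Qed.

Lemma run_iff_minimal (R : realType) x :
  digits3 x -> run [::] x <-> minimal_weight (golden R) x.
Proof.
move=> hx; split; first exact: run_minimal.
by move=> hm; apply: (@run_avoids_H _ [::]) => // -[h hh] /(heavy_H R hh).
Qed.

(** * Recognition by a finite automaton *)

Definition states : seq (seq item) := unzip1 potential.

Lemma delta_states q a q' : q \in states -> delta q a = Some q' -> q' \in states.
Proof.
have hst : all (fun p => all (fun b => oapp (mem states) true (delta p b)) alphabet) states.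
  by vm_compute.
move=> hq eq_q'; have ha : a \in alphabet by move: eq_q'; rewrite /delta; case: (a \in _).
by have /allP/(_ _ hq)/allP/(_ _ ha) := hst; rewrite eq_q'.
Qed.

(** All states are terminal, since a word is rejected only through a missing edge. *)
Definition run_automaton : automaton :=
  @Automaton (seq_sub states : finType)
    [seq e <- [seq (pa, p') | pa <- [seq (p, a) | p <- enum {: seq_sub states}, a <- alphabet],
                              p' <- enum {: seq_sub states}]
       | delta (val e.1.1) e.1.2 == Some (val e.2)]
    [set p | val p == [::]] setT.

Lemma edges_run_automaton (p p' : state run_automaton) a :
  ((p, a, p') \in edges run_automaton) = (delta (val p) a == Some (val p')).
Proof.
rewrite mem_filter andb_idr // {1}/delta; case: ifP => // /andP[ha _] _.
apply: allpairs_f; last by rewrite mem_enum.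
apply: (@allpairs_f _ _ _ pair); last exact: ha.
by rewrite mem_enum.
Qed.

Lemma accepts_from_run (p : state run_automaton) x : accepts_from p x <-> run (val p) x.
Proof.
elim: x p => [|a x IH] p /=; first by rewrite inE.
split=> [[p']|].
  by rewrite edges_run_automaton => /eqP -> /IH.
case ed: (delta (val p) a) => [q'|] // hr.
pose p' : state run_automaton := SeqSub (delta_states (valP p) ed).
by exists p'; [rewrite edges_run_automaton ed | apply/IH].
Qed.

Lemma run_digits3 q x : run q x -> digits3 x.
Proof.
elim: x q => //= a x IH q; rewrite /delta.
by case: ifP => // /andP[-> _] /IH.
Qed.

Theorem mainTheorem7 (R : realType) :
  (forall x : word, digits3 x ->
     (minimal_weight (golden R) x <-> ~ (exists2 h : word, H h & infix h x)))
  /\ recognizable (fun x : word => digits3 x /\ minimal_weight (golden R) x).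
Proof.
split=> [x hx|].
  split=> [hm [h hh hi]|noH]; first exact/hm/(heavy_H R hh).
  by apply: run_minimal => //; apply: (@run_avoids_H _ [::]).
exists run_automaton => x; split.
  case=> p; rewrite inE => /eqP p0 /accepts_from_run; rewrite p0 => hr.
  have hx := run_digits3 hr; split=> //; exact: run_minimal.
case=> hx /(run_iff_minimal R hx) hr.
have h0 : [::] \in states by vm_compute.
exists (SeqSub h0 : state run_automaton); first by rewrite inE.
exact/accepts_from_run.
Qed.
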